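(* Let $G$ be a finite simple graph that is $(P_2\cup P_4)$-free and butterfly-free. Then $\chi(G)\le \frac{\omega(G)^2+3\omega(G)-2}{2}$.
   Context: $P_t$ denotes the path on $t$ vertices. For vertex-disjoint graphs $G_1,G_2$, $G_1\cup G_2$ is their disjoint union (no edges between them). A graph $G$ is $H$-free if no induced subgraph of $G$ is isomorphic to $H$. A butterfly is the graph consisting of two triangles sharing exactly one vertex. $\chi(G)$ is the chromatic number and $\omega(G)$ the clique number of $G$. *)

(* Defs.v *)
From HB Require Import structures.
From mathcomp Require Import all_boot all_order all_algebra.

Set Implicit Arguments.
Unset Strict Implicit.
Unset Printing Implicit Defensive.

Record sgraph := SGraph {
  vertex :> finType;
  edge : rel vertex;
  edge_sym : symmetric edge;
  edge_irrefl : irreflexive edge }.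

Definition isomorphic (G H : sgraph) : Prop :=
  exists f : G -> H, bijective f /\ forall x y, edge (f x) (f y) = edge x y.

Section Induced.
Variables (G : sgraph) (S : {set G}).

Definition induced_edge : rel {x : G | x \in S} :=
  fun x y => edge (val x) (val y).

Lemma induced_edge_sym : symmetric induced_edge.
Proof. by move=> x y; apply: edge_sym. Qed.

Lemma induced_edge_irrefl : irreflexive induced_edge.
Proof. by move=> x; apply: edge_irrefl. Qed.

Definition induced : sgraph := SGraph induced_edge_sym induced_edge_irrefl.
End Induced.

Definition free_of (H G : sgraph) : Prop :=
  forall S : {set G}, ~ isomorphic (induced S) H.

Section Path.
Variable t : nat.

Definition path_edge : rel 'I_t :=
  fun i j => (i.+1 == j :> nat) || (j.+1 == i :> nat).

Lemma path_edge_sym : symmetric path_edge.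
Proof. by move=> i j; rewrite /path_edge orbC. Qed.

Lemma path_edge_irrefl : irreflexive path_edge.
Proof. by move=> i; rewrite /path_edge orbb -[X in _ == X]add0n -add1n eqn_add2r. Qed.

(* [t] counts vertices, not edges. *)
Definition path_graph : sgraph := SGraph path_edge_sym path_edge_irrefl.
End Path.

Section DisjointUnion.
Variables G1 G2 : sgraph.

Definition disjoint_union_edge : rel (G1 + G2)%type := fun u v =>
  match u, v with
  | inl x, inl y => edge x y
  | inr x, inr y => edge x y
  | _, _ => false
  end.

Lemma disjoint_union_edge_sym : symmetric disjoint_union_edge.
Proof. by case=> x [] y //=; apply: edge_sym. Qed.

Lemma disjoint_union_edge_irrefl : irreflexive disjoint_union_edge.
Proof. by case=> x /=; apply: edge_irrefl. Qed.

Definition disjoint_union : sgraph :=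
  SGraph disjoint_union_edge_sym disjoint_union_edge_irrefl.
End DisjointUnion.

(* The triangles are {0, 1, 2} and {0, 3, 4}. *)
Definition butterfly_edges : seq (nat * nat) :=
  [:: (0, 1); (0, 2); (1, 2); (0, 3); (0, 4); (3, 4)].

Definition butterfly_edge : rel 'I_5 := fun i j =>
  ((i : nat, j : nat) \in butterfly_edges)
  || ((j : nat, i : nat) \in butterfly_edges).

Lemma butterfly_edge_sym : symmetric butterfly_edge.
Proof. by move=> i j; rewrite /butterfly_edge orbC. Qed.

Lemma butterfly_edge_irrefl : irreflexive butterfly_edge.
Proof. by case=> [[|[|[|[|[|i]]]]] lti]. Qed.

Definition butterfly : sgraph :=
  SGraph butterfly_edge_sym butterfly_edge_irrefl.

Section Invariants.
Variable G : sgraph.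

Definition proper_coloring k (c : {ffun G -> 'I_k}) : bool :=
  [forall x, forall y, edge x y ==> (c x != c y)].

Definition colorable (k : nat) : bool :=
  [exists c : {ffun G -> 'I_k}, proper_coloring c].

Lemma colorable_exists : exists k, colorable k.
Proof.
exists #|G|; apply/existsP; exists [ffun x => enum_rank x].
apply/forallP=> x; apply/forallP=> y; apply/implyP=> xy; rewrite !ffunE.
by apply: contraTneq xy => /enum_rank_inj ->; rewrite edge_irrefl.
Qed.

Definition chromatic_number : nat := ex_minn colorable_exists.

Definition clique (K : {set G}) : bool :=
  [forall x in K, forall y in K, (x != y) ==> edge x y].

Definition clique_number : nat := \max_(K : {set G} | clique K) #|K|.
End Invariants.

(* Main.v *)
(** Wagner's argument. Fix a maximum clique [A] with two distinguished vertices
    [a] and [b], and let [N v] be the set of non-neighbours of [v] in [A]; it is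
    nonempty by maximality of [A].
    - The vertices with [N v = {i}] form an independent set for each [i].
    - The vertices adjacent to neither [a] nor [b] induce a P4-free graph, as
      [ab] is a P2. Greedy colouring is optimal on P4-free graphs, so [omega]
      colours suffice.
    - Any other vertex [v] is labelled by a pair [P] included in [N v], chosen to
      contain [a] if [N v] does. Equally labelled vertices are then all adjacent
      to a common vertex of [A] outside [P] ([b] if [P] contains [a], and [a]
      otherwise), so an edge between two of them would give a butterfly. The
      label [{a, b}] does not occur.
    The total is [omega + omega + (binomial omega 2 - 1)]. *)
Require Import Defs.
From mathcomp Require Import all_boot all_order all_algebra.
From mathcomp Require Import zify.

Set Implicit Arguments.
Unset Strict Implicit.
Unset Printing Implicit Defensive.

Import GRing.Theory Num.Theory.

(** * Embeddings of forbidden graphs *)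

Section InducedSubgraphs.
Variable G : sgraph.

(** Corestricted to its image, [f] is a bijection onto an induced subgraph; its inverse [h] is the
    isomorphism that [free_of] forbids. *)
Lemma free_of_embedding (H : sgraph) (f : H -> G) :
  free_of H G -> injective f ->
  (forall x y, edge (f x) (f y) = edge x y) -> False.
Proof.
move=> Hfree f_inj f_edge; apply: (Hfree (f @: [set: H])).
have fS y : f y \in f @: [set: H] by rewrite imset_f.
pose g y : induced (f @: [set: H]) := exist (fun x => x \in f @: [set: H]) (f y) (fS y).
have g_edge x y : edge (g x) (g y) = edge x y by rewrite -f_edge.
have g_inj : injective g by move=> x y /(congr1 val) /f_inj.
have g_card : #|induced (f @: [set: H])| <= #|H|.
  by rewrite card_sig (eq_card (B := f @: [set: H])) // card_imset // cardsT.
have [h gK hK] := inj_card_bij g_inj g_card.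
exists h; split; first by exists g.
by move=> x y; rewrite -g_edge !hK.
Qed.

(* Without twins, preserving adjacency and non-adjacency forces injectivity. *)
Lemma free_of_twin_free (H : sgraph) (f : H -> G) :
  (forall x y : H, (forall z, edge x z = edge y z) -> x = y) ->
  free_of H G -> (forall x y, edge (f x) (f y) = edge x y) -> False.
Proof.
move=> Htwin Hfree f_edge; apply: (free_of_embedding Hfree _ f_edge) => x y fxy.
by apply: Htwin => z; rewrite -!f_edge fxy.
Qed.

(** No two vertices of the butterfly have the same neighbourhood, so the adjacencies alone make the
    five vertices distinct. *)
Lemma butterfly_freeP (o u v x y : G) : free_of butterfly G ->
  edge o u -> edge o v -> edge o x -> edge o y -> edge u v -> edge x y ->
  ~~ edge u x -> ~~ edge u y -> ~~ edge v x -> ~~ edge v y -> False.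
Proof.
move=> bf ou ov ox oy uv xy /negPf ux /negPf uy /negPf vx /negPf vy.
pose f (i : butterfly) := nth o [:: o; u; v; x; y] (i : 'I_5).
refine (free_of_twin_free (f := f) _ bf _).
  move=> i j ij; apply: val_inj; move: ij.
  case: i => [[|[|[|[|[|i]]]]] lti] //; case: j => [[|[|[|[|[|j]]]]] ltj] //= ij;
    by move: (ij (inord 0)) (ij (inord 1)) (ij (inord 2)) (ij (inord 3)) (ij (inord 4));
       rewrite /butterfly_edge /= !inordK.
case=> [[|[|[|[|[|i]]]]] lti] //; case=> [[|[|[|[|[|j]]]]] ltj] //=;
  by rewrite ?edge_irrefl // ?(ou, ov, ox, oy, uv, xy, ux, uy, vx, vy) //
       edge_sym ?(ou, ov, ox, oy, uv, xy, ux, uy, vx, vy).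
Qed.

(** The listed edges and non-edges force four distinct vertices, hence an induced P4. *)
Definition P4_free_on (S : {set G}) := forall p q r s,
  p \in S -> q \in S -> r \in S -> s \in S ->
  edge p q -> edge q r -> edge r s ->
  ~~ edge p r -> ~~ edge p s -> ~~ edge q s -> False.

Lemma P2UP4_free_anticomplete (a b : G) :
  free_of (disjoint_union (path_graph 2) (path_graph 4)) G -> edge a b ->
  P4_free_on [set v | ~~ edge v a && ~~ edge v b].
Proof.
move=> pf ab p q r s; rewrite !inE.
move=> /andP[/negPf pa /negPf pb] /andP[/negPf qa /negPf qb].
move=> /andP[/negPf ra /negPf rb] /andP[/negPf sa /negPf sb].
move=> pq qr rs /negPf pr /negPf ps /negPf qs.
pose f (z : disjoint_union (path_graph 2) (path_graph 4)) := match z with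
  | inl i => nth a [:: a; b] (i : 'I_2)
  | inr i => nth p [:: p; q; r; s] (i : 'I_4) end.
refine (free_of_twin_free (f := f) _ pf _).
  case=> [[[|[|i]] lti]|[[|[|[|[|i]]]] lti]] // [[[|[|j]] ltj]|[[|[|[|[|j]]]] ltj]] //= ij;
    solve [congr inl; exact: val_inj | congr inr; exact: val_inj |
    by move: (ij (inl (inord 0))) (ij (inl (inord 1))) (ij (inr (inord 0)))
        (ij (inr (inord 1))) (ij (inr (inord 2))) (ij (inr (inord 3)));
       rewrite /= /path_edge /= !inordK].
case=> [[[|[|i]] lti]|[[|[|[|[|i]]]] lti]] // [[[|[|j]] ltj]|[[|[|[|[|j]]]] ltj]] //=;
  by rewrite ?edge_irrefl // ?(pa, pb, qa, qb, ra, rb, sa, sb, ab, pq, qr, rs, pr, ps, qs) //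
     edge_sym ?(pa, pb, qa, qb, ra, rb, sa, sb, ab, pq, qr, rs, pr, ps, qs).
Qed.

End InducedSubgraphs.

(** * Colourings of vertex sets *)

Section Colorings.
Variable G : sgraph.
Implicit Types (S K : {set G}) (k : nat).

Lemma cliqueP K :
  reflect {in K &, forall x y, x != y -> edge x y} (clique K).
Proof.
apply: (iffP forall_inP) => [KP x y Kx Ky | KP x Kx].
  exact/implyP/(forall_inP (KP x Kx)).
by apply/forall_inP => y Ky; apply/implyP/KP.
Qed.

Lemma clique_add K x :
  clique K -> {in K, forall y, edge x y} -> clique (x |: K).
Proof.
move=> /cliqueP KP xK; apply/cliqueP => y z /setU1P[->|Ky] /setU1P[->|Kz].
- by rewrite eqxx.
- by rewrite xK.
- by rewrite edge_sym xK.
- exact: KP.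
Qed.

Lemma clique_number_ge K : clique K -> #|K| <= clique_number G.
Proof. exact: leq_bigmax_cond. Qed.

Lemma maximum_clique : exists2 K : {set G}, clique K & #|K| = clique_number G.
Proof.
have cl0 : clique (set0 : {set G}) by apply/cliqueP => x; rewrite inE.
have : 0 < #|@clique G| by apply/card_gt0P; exists set0.
by case/(eq_bigmax_cond (fun K => #|K|)) => K clK eqK; exists K.
Qed.

Definition proper_on S (T : eqType) (c : G -> T) :=
  {in S &, forall x y, edge x y -> c x != c y}.

Definition colorable_on S k :=
  exists2 c : G -> nat, proper_on S c & {in S, forall x, c x < k}.

Lemma colorable_on_setT k : colorable_on [set: G] k -> chromatic_number G <= k.
Proof.
case=> c c_proper c_lt; rewrite /chromatic_number; case: ex_minnP => m _; apply.
have c_ltT x : c x < k by rewrite c_lt.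
apply/existsP; exists [ffun x => Ordinal (c_ltT x)].
apply/forallP => x; apply/forallP => y; apply/implyP => xy; rewrite !ffunE.
by rewrite -val_eqE /= c_proper.
Qed.

(** Labels such as vertices or pairs serve as colours: their position in the enumeration of [D] is a
    number below [#|D|]. *)
Lemma colorable_on_image S (T : finType) (D : {set T}) (f : G -> T) :
  proper_on S f -> {in S, forall x, f x \in D} -> colorable_on S #|D|.
Proof.
move=> f_proper fD; exists (fun x => index (f x) (enum D)) => [x y Sx Sy xy | x Sx].
  apply: contra (f_proper x y Sx Sy xy) => /eqP.
  by move/(index_inj (f x)) => ->; rewrite ?mem_enum ?fD.
by rewrite cardE index_mem mem_enum fD.
Qed.

Lemma colorable_onU S1 S2 k1 k2 :
  colorable_on S1 k1 -> colorable_on S2 k2 -> colorable_on (S1 :|: S2) (k1 + k2).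
Proof.
move=> [c1 c1P c1lt] [c2 c2P c2lt].
exists (fun x => if x \in S1 then c1 x else k1 + c2 x) => [x y | x]; rewrite !inE.
  case: (boolP (x \in S1)) => [x1 _ | _ /= x2]; case: (boolP (y \in S1)) => [y1 _ | _ /= y2] xy.
  - exact: c1P.
  - by have := c1lt _ x1; lia.
  - by have := c1lt _ y1; lia.
  - by rewrite eqn_add2l c2P.
case: (boolP (x \in S1)) => [x1 _ | _ /= x2].
  by have := c1lt _ x1; lia.
by have := c2lt _ x2; lia.
Qed.

(** Colour all but one vertex [x], then give [x] the least colour absent from its neighbours.
    Minimality gives the property at [x]; the other vertices keep their colours and witnesses. *)
Lemma greedy_coloring S : exists2 c : G -> nat, proper_on S c &
  {in S, forall x j, j < c x -> exists2 y, y \in S & edge x y && (c y == j)}.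
Proof.
have [n] := ubnP #|S|; elim: n S => // n IHn S ltSn.
have [-> | [x Sx]] := set_0Vmem S.
  by exists (fun=> 0) => x; rewrite inE.
have [|c cP cG] := IHn (S :\ x); first by move: ltSn; rewrite (cardsD1 x S) Sx.
pose missing m := [forall y in S :\ x, edge x y ==> (c y != m)].
(* One more than every colour used so far is missing. *)
have ex_m : exists m, missing m.
  exists (\max_(y in S :\ x) c y).+1; apply/forall_inP => y Sy; apply/implyP => _.
  by rewrite neq_ltn ltnS leq_bigmax_cond.
have [m mP m_min] := ex_minnP ex_m.
have m_ok y : y \in S -> y != x -> edge x y -> c y != m.
  by move=> Sy yx; apply/implyP/(forall_inP mP); rewrite !inE yx.
exists (fun y => if y == x then m else c y) => [y z Sy Sz yz | y Sy j].
  case: (eqVneq y x) => [eyx | nyx]; case: (eqVneq z x) => [ezx | nzx].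
  - by move: yz; rewrite eyx ezx edge_irrefl.
  - by rewrite eq_sym m_ok // -eyx.
  - by rewrite m_ok // edge_sym -ezx.
  - by apply: cP; rewrite ?inE ?nyx ?nzx.
case: (eqVneq y x) => [-> ltjm | nyx ltj].
  have : ~~ missing j by apply: contraTN ltjm => /m_min; rewrite -leqNgt.
  rewrite negb_forall_in => /exists_inP[z]; rewrite !inE => /andP[nzx Sz].
  by rewrite negb_imply negbK => zP; exists z; rewrite // (negPf nzx).
have [|z] := cG y _ j ltj; first by rewrite !inE nyx.
by rewrite !inE => /andP[nzx Sz] zP; exists z; rewrite // (negPf nzx).
Qed.

(* A clique whose vertices all have colours above [i] extends by a vertex of
   colour [i]: choose [v] of colour [i] with the most neighbours in the clique;
   a non-neighbour [u] of [v] in it has a neighbour [w] of colour [i], and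
   maximality gives [z] in the clique adjacent to [v] only, so [v z u w] is an
   induced P4. *)
Lemma P4_free_colorable S : P4_free_on S -> colorable_on S (clique_number G).
Proof.
move=> SP4; have [c cP cG] := greedy_coloring S; exists c => // x0 Sx0.
(* The clique grows downwards through the colours from [c x0]; at [i = 0] it has [c x0 + 1]
   vertices, so [c x0] is below the clique number. *)
have clq j : forall i, i + j = c x0 -> exists2 Q : {set G}, clique Q &
    [/\ Q \subset S, #|Q| = j.+1 & {in Q, forall q, i <= c q}].
  elim: j => [|j IHj] i ij.
    exists [set x0].
      by apply/cliqueP => x y /set1P-> /set1P->; rewrite eqxx.
    rewrite sub1set cards1; split=> // q /set1P->; lia.
  have [|Q /[dup] Qcl /cliqueP QP [QS Qcard Qc]] := IHj i.+1; first by lia.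
  have nbr q : q \in Q -> exists2 y, y \in S & edge q y && (c y == i).
    by move=> Qq; apply: cG; [exact: (subsetP QS) | exact: Qc].
  have [q Qq] : exists q, q \in Q by apply/card_gt0P; rewrite Qcard.
  have [y Sy /andP[_ cy]] := nbr q Qq.
  pose d v := #|[set z in Q | edge v z]|.
  case: (@arg_maxnP _ y [pred v | (v \in S) && (c v == i)] d) => /=.
    by rewrite Sy.
  move=> v /andP[Sv /eqP cv] v_max.
  have vQ : {in Q, forall u, edge v u}.
    move=> u Qu; apply/negPn/negP => nvu.
    have [w Sw /andP[uw /eqP cw]] := nbr u Qu.
    have nvw : ~~ edge v w.
      by apply/negP => vw; have := cP v w Sv Sw vw; rewrite cv cw eqxx.
    have [z /andP[Qz vz] nwz] : exists2 z, (z \in Q) && edge v z & ~~ edge w z.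
      case: (boolP [exists (z | (z \in Q) && edge v z), ~~ edge w z]).
        by case/exists_inP => z; exists z.
      rewrite negb_exists_in => /forall_inP vw; exfalso.
      have /v_max : (w \in S) && (c w == i) by rewrite Sw cw eqxx.
      apply/negP; rewrite -ltnNge; apply: proper_card; apply/properP; split.
        by apply/subsetP => t; rewrite !inE => /[dup] /vw; rewrite negbK => -> /andP[->].
      by exists u; rewrite !inE Qu //= edge_sym.
    have nzu : z != u by apply: contraTneq vz => ->.
    have [Sz Su] : z \in S /\ u \in S by split; apply: (subsetP QS).
    have zu : edge z u by apply: QP.
    by apply: (SP4 v z u w) => //; rewrite edge_sym.
  have nQv : v \notin Q by apply/negP => /Qc; rewrite cv ltnn.
  exists (v |: Q); first exact: clique_add.
  rewrite subUset sub1set Sv QS cardsU1 nQv Qcard; split=> // z /setU1P[->|/Qc]; lia.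
have [//|Q Qcl [_ Qcard _]] := clq (c x0) 0.
by rewrite -Qcard clique_number_ge.
Qed.

End Colorings.

(** * Splitting the vertices along a maximum clique *)

Section Wagner.
Variables (G : sgraph) (A : {set G}).
Hypotheses (A_clique : clique A) (A_max : #|A| = clique_number G).

(** A vertex of [A] is its own sole non-neighbour, so [A] lies in the singleton class. *)
Definition non_neighbours (v : G) := [set i in A | ~~ edge v i].

Lemma non_neighbours_gt0 v : 0 < #|non_neighbours v|.
Proof.
rewrite lt0n cards_eq0; apply/eqP => N0.
have vA : {in A, forall i, edge v i}.
  by move=> i Ai; apply/negPn/negP => vi; have := in_set0 i; rewrite -N0 inE Ai vi.
have nAv : v \notin A by apply/negP => /vA; rewrite edge_irrefl.
by have := clique_number_ge (clique_add A_clique vA); rewrite cardsU1 nAv A_max ltnn.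
Qed.

(* If two adjacent vertices had the same unique non-neighbour [i] in [A],
   replacing [i] by both of them would give a larger clique. *)
Lemma colorable_one_non_neighbour :
  colorable_on [set v | #|non_neighbours v| == 1] #|A|.
Proof.
pose f v := odflt v [pick i in non_neighbours v].
have fP v : #|non_neighbours v| == 1 -> non_neighbours v = [set f v].
  case/cards1P => i vi; rewrite /f vi; case: pickP => [j /set1P -> //|/(_ i)].
  by rewrite !inE eqxx.
apply: (@colorable_on_image _ _ _ _ f) => [v w | v]; rewrite !inE; last first.
  by move=> /fP vi; have : f v \in non_neighbours v by [rewrite vi set11]; rewrite inE => /andP[].
move=> /fP vi /fP wi vw; apply/eqP => fvw; rewrite -fvw in wi.
set i := f v in vi wi.
have Ai : i \in A by have : i \in non_neighbours v by [rewrite vi set11]; rewrite inE => /andP[].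
have nbr u : non_neighbours u = [set i] -> {in A :\ i, forall k, edge u k}.
  move=> uN k; rewrite !inE => /andP[ki Ak]; apply/negPn/negP => uk.
  by have := in_set1 k i; rewrite -uN inE Ak uk (negPf ki).
have out u : non_neighbours u = [set i] -> u \notin A :\ i.
  by move=> uN; apply/negP => /(nbr u uN); rewrite edge_irrefl.
have clA : clique (A :\ i).
  by apply/cliqueP => x y /setD1P[_ Ax] /setD1P[_ Ay]; apply/cliqueP: x y Ax Ay.
have clw := clique_add clA (nbr w wi).
have clvw : clique (v |: (w |: A :\ i)).
  by apply: clique_add => // k /setU1P[->|/(nbr v vi)].
have := clique_number_ge clvw.
rewrite !cardsU1 (negPf (out w wi)) inE (negPf (out v vi)) inE -A_max (cardsD1 i A) Ai.
by case: eqP vw => [->|_] /=; rewrite ?edge_irrefl // ltnn.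
Qed.

Variables a b : G.
Hypotheses (Aa : a \in A) (Ab : b \in A) (neq_ab : a != b).
Hypothesis G_butterfly_free : free_of butterfly G.

Definition other_pairs :=
  [set P : {set G} | P \subset A & #|P| == 2] :\ [set a; b].

Lemma card_other_pairs : #|other_pairs|.+1 = 'C(#|A|, 2).
Proof.
rewrite -cards_draws (cardsD1 [set a; b] [set P : {set G} | _ & _]) inE cards2 neq_ab.
by rewrite subUset !sub1set Aa Ab.
Qed.

Lemma colorable_other_pairs :
  colorable_on [set v | (1 < #|non_neighbours v|) && (edge v a || edge v b)]
    #|other_pairs|.
Proof.
(* The last clause makes [a] a neighbour of [v] whenever [a] is outside the label. *)
pose good v (P : {set G}) :=
  [&& P \subset non_neighbours v, #|P| == 2 & (a \in non_neighbours v) ==> (a \in P)].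
pose f v := odflt set0 [pick P | good v P].
have fP v : 1 < #|non_neighbours v| -> good v (f v).
  move=> v2; rewrite /f; case: pickP => //= none; exfalso.
  case: (boolP (a \in non_neighbours v)) => [Na | nNa].
    have : 0 < #|non_neighbours v :\ a| by move: v2; rewrite (cardsD1 a) Na.
    case/card_gt0P => j /setD1P[ja Nj]; have /negP := none [set a; j]; apply.
    by rewrite /good subUset !sub1set Na Nj cards2 (eq_sym a) ja set21 implybT.
  case/card_gt1P: v2 => i [j [Ni Nj ij]]; have /negP := none [set i; j]; apply.
  by rewrite /good subUset !sub1set Ni Nj cards2 ij (negPf nNa).
apply: (@colorable_on_image _ _ _ _ f) => [v w | v]; rewrite !inE; last first.
  move=> /andP[/fP /and3P[fN f2 _] vab]; rewrite f2 andbT; apply/andP; split.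
    (* The label [[set a; b]] would make [v] adjacent to neither [a] nor [b]. *)
    apply: contraTneq vab => fab; rewrite negb_or.
    have := subsetP fN a; have := subsetP fN b; rewrite fab set21 set22 !inE.
    by move=> /(_ isT) /andP[_ ->] /(_ isT) /andP[_ ->].
  by apply: subset_trans fN _; apply/subsetP => i; rewrite inE => /andP[].
move=> /andP[/fP /and3P[vN v2 va] vab] /andP[/fP /and3P[wN w2 wa] wab] vw.
apply/eqP => fvw; rewrite -fvw in wN wa.
have /cards2P[i [j [ij Pij]]] := v2.
have : i \in non_neighbours v by rewrite (subsetP vN) // Pij set21.
have : j \in non_neighbours v by rewrite (subsetP vN) // Pij set22.
have : i \in non_neighbours w by rewrite (subsetP wN) // Pij set21.
have : j \in non_neighbours w by rewrite (subsetP wN) // Pij set22.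
rewrite !inE => /andP[_ wj] /andP[_ wi] /andP[Aj vj] /andP[Ai vi].
have nbr u : edge u a || edge u b -> f v \subset non_neighbours u ->
    (a \in non_neighbours u) ==> (a \in f v) ->
    edge u (if a \in f v then b else a).
  move=> uab /subsetP uN; case: (boolP (a \in f v)) => [/uN|_].
    by rewrite inE => /andP[_ /negPf ua] _; move: uab; rewrite ua.
  by rewrite implybF inE Aa negbK.
have := nbr v vab vN va; have := nbr w wab wN wa.
set k := (if _ then _ else _) => wk vk.
have Ak : k \in A by rewrite /k; case: ifP.
have adj u : u \in A -> ~~ edge v u -> edge k u.
  move=> Au vu; apply/(cliqueP _ A_clique) => //.
  by apply: contraNneq vu => <-.
(* The triangles [k v w] and [k i j] meet in [k]; both [i] and [j] are non-neighbours of [v] and of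
   [w]. *)
apply: (@butterfly_freeP _ k v w i j) => //.
- by rewrite edge_sym.
- by rewrite edge_sym.
- exact: adj.
- exact: adj.
- exact/(cliqueP _ A_clique).
Qed.

Hypothesis G_P2UP4_free : free_of (disjoint_union (path_graph 2) (path_graph 4)) G.

Lemma chromatic_number_le_pairs :
  chromatic_number G <= #|A| + #|other_pairs| + #|A|.
Proof.
have ab : edge a b by apply/(cliqueP _ A_clique).
have abP4 := P4_free_colorable (P2UP4_free_anticomplete G_P2UP4_free ab).
apply: colorable_on_setT; rewrite {2}A_max.
have := colorable_onU (colorable_onU colorable_one_non_neighbour colorable_other_pairs) abP4.
(* The three classes cover [G] since every vertex has at least one non-neighbour in [A]. *)
set U := (X in colorable_on X _); suff -> : U = [set: G] by [].
apply/setP => v; rewrite !inE -negb_or.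
by have := non_neighbours_gt0 v; case: (edge v a || edge v b); lia.
Qed.

End Wagner.

(** * The numerical bound *)

Lemma chromatic_number_le1 (G : sgraph) :
  clique_number G <= 1 -> chromatic_number G <= 1.
Proof.
move=> w1; apply: colorable_on_setT; exists (fun=> 0) => // x y _ _ xy.
(* An edge would give a clique of two vertices, so the constant colouring is proper. *)
have cl1 : clique [set y].
  by apply/cliqueP => u v /set1P-> /set1P->; rewrite eqxx.
have clxy : clique (x |: [set y]).
  by apply: clique_add => // z /set1P->.
have := leq_trans (clique_number_ge clxy) w1.
by rewrite cards2; case: eqP xy => [->|]; rewrite ?edge_irrefl.
Qed.

(** The bound is cleared of division and subtraction to stay in [nat]. A vertex ensures a positive
    clique number; clique number 1 is treated apart, as the main argument needs two vertices in
    [A]. *)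
Lemma chromatic_number_bound (G : sgraph) : 0 < #|G| ->
  free_of (disjoint_union (path_graph 2) (path_graph 4)) G ->
  free_of butterfly G ->
  2 * chromatic_number G + 2 <= clique_number G ^ 2 + 3 * clique_number G.
Proof.
move=> /card_gt0P[x _] P2UP4_free butterfly_free.
have w_gt0 : 0 < clique_number G.
  rewrite -(cards1 x); apply: clique_number_ge.
  by apply/cliqueP => u v /set1P-> /set1P->; rewrite eqxx.
have [w_le1 | w_gt1] := leqP (clique_number G) 1.
  have := chromatic_number_le1 w_le1.
  by have -> : clique_number G = 1; lia.
have [A A_clique A_max] := maximum_clique G.
have /card_gt1P[a [b [Aa Ab ab]]] : 1 < #|A| by rewrite A_max.
have := chromatic_number_le_pairs A_clique A_max Aa Ab ab butterfly_free P2UP4_free.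
(* With [w] the clique number, [2 * 'C(w, 2) = (w - 1) * w] turns twice [2 * w + 'C(w, 2) - 1], plus
   2, into [w ^ 2 + 3 * w]. *)
have := card_other_pairs Aa Ab ab; have := mul_bin_left #|A| 1.
rewrite bin1 A_max; move: (clique_number G) #|_| 'C(_, _) => w p B; nia.
Qed.

Local Open Scope ring_scope.

Theorem theorem1p2 (G : sgraph) (G_nonempty : (0 < #|G|)%N)
    (G_P2UP4_free : free_of (disjoint_union (path_graph 2) (path_graph 4)) G)
    (G_butterfly_free : free_of butterfly G) :
  (chromatic_number G)%:R
    <= ((clique_number G)%:R ^+ 2 + 3 * (clique_number G)%:R - 2) / 2 :> rat.
Proof.
have := chromatic_number_bound G_nonempty G_P2UP4_free G_butterfly_free.
by rewrite ler_pdivlMr // lerBrDr mulrC -natrX -!natrM -!natrD ler_nat.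
Qed.
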